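(* Each one of the following eight families of invariants of knots in $S^3$ determines all the other families: (1) $\{J_n(q) \mid n\in\mathbb{Z}_{\ge 0}\}$; (2) $\{DJ^{(m)}_n(q)\mid n\in\mathbb{Z}_{\ge 0},\ m\in\mathbb{Z}\}$; (3) $\{DJ^{(m)}(x,q)\mid m\in\mathbb{Z}\}$; (4) $\{DJ^{(m)}(q)\mid m\in\mathbb{Z}\}$; (5) $\{J_n(\zeta)\mid n\in\mathbb{Z}_{\ge 0},\ \zeta\in\mu\}$; (6) $\{DJ^{(m)}_n(\zeta)\mid n\in\mathbb{Z}_{\ge 0},\ m\in\mathbb{Z},\ \zeta\in\mu\}$; (7) $\{DJ^{(m)}(x,\zeta)\mid m\in\mathbb{Z},\ \zeta\in\mu\}$; (8) $\{DJ^{(m)}(\zeta)\mid m\in\mathbb{Z},\ \zeta\in\mu\}$. That is, if two knots $K$ and $K'$ have the same invariants in one of these families (for all values of the indices of that family), then they have the same invariants in each of the other families.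
   Context: $\mu$ denotes the set of complex roots of unity. For a knot $K$ in $S^3$ (omitted from the notation) and $n\ge 1$, $J_n(q)=J^K_n(q)\in\mathbb{Z}[q^{\pm1}]$ is the colored Jones polynomial of $K$ colored by the $n$-dimensional irreducible representation of $\mathfrak{sl}_2$ and normalized to be $1$ at the unknot. Notation: $(a;q)_k=\prod_{j=0}^{k-1}(1-aq^j)$, $(a;q^{-1})_k=\prod_{j=0}^{k-1}(1-aq^{-j})$. Set $$c_{n,k}(q)=q^{-kn}(q^{n+1};q)_k\,(q^{n-1};q^{-1})_k,\qquad c_k(x,q)=x^{-k}(qx;q)_k\,(q^{-1}x;q^{-1})_k,$$ so $c_{n,k}(q)=c_k(q^n,q)$, and $c_{n,k}(q)=0$ for $k\ge n\ge 1$. Habiro polynomials (known result of Habiro): there is a unique sequence $H_k(q)=H_k^K(q)$, $k\ge 0$, with $J_n(q)=\sum_{k=0}^\infty c_{n,k}(q)H_k(q)$ for all $n\ge 1$, and moreover $H_k(q)\in\mathbb{Z}[q^{\pm1}]$ for all $k$. The Habiro ring is $\widehat{\mathbb{Z}[q]}=\varprojlim_n \mathbb{Z}[q]/((q;q)_n)$ (in which $q$ is invertible), and the colored Habiro ring is $\Lambda=\varprojlim_n\mathbb{Z}[q^{\pm1}][x+x^{-1}-2]/(c_n(x,q))$. For $m\in\mathbb{Z}$ and $n\ge 0$ define $$DJ_n^{(m)}(q)=\sum_{k=0}^\infty c_{n,k}(q)H_k(q)q^{km},\qquad DJ^{(m)}(x,q)=\sum_{k=0}^\infty c_k(x,q)H_k(q)q^{km}\in\Lambda,$$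 $$DJ^{(m)}(q)=\sum_{k=0}^\infty (q;q)_k(q^{-1};q^{-1})_kH_k(q)q^{km}\in\widehat{\mathbb{Z}[q]}.$$ Thus $DJ^{(m)}_n(q)\in\mathbb{Z}[q^{\pm1}]$ for $n\ge1$, $DJ^{(m)}_0(q)=DJ^{(m)}(q)\in\widehat{\mathbb{Z}[q]}$, and $DJ_n^{(0)}(q)=J_n(q)$ for $n\geq 1$. For $n=0$, $J_0(q)$ means $\sum_{k\ge0}c_{0,k}(q)H_k(q)=DJ^{(0)}(q)\in\widehat{\mathbb{Z}[q]}$. For $\zeta\in\mu$, $J_n(\zeta)$, $DJ_n^{(m)}(\zeta)$ and $DJ^{(m)}(\zeta)$ denote the values at $q=\zeta$ (for elements of $\widehat{\mathbb{Z}[q]}$, the image under the evaluation map $\widehat{\mathbb{Z}[q]}\to\mathbb{Z}[\zeta]$, $q\mapsto\zeta$), and $DJ^{(m)}(x,\zeta)$ denotes $\sum_{k\ge0}c_k(x,\zeta)H_k(\zeta)\zeta^{km}$, the image of $DJ^{(m)}(x,q)$ in $\varprojlim_n\mathbb{Z}[\zeta][x+x^{-1}-2]/(c_n(x,\zeta))$. *)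

(* Defs.v *)
From HB Require Import structures.
From mathcomp Require Import all_boot all_order all_algebra.
From mathcomp Require Import fraction algC.
From mathcomp Require Import all_classical all_reals topology normedtype.
From mathcomp Require Import ring.
Import Order.TTheory GRing.Theory Num.Theory.
Import numFieldNormedType.Exports.

Set Implicit Arguments.
Unset Strict Implicit.
Unset Printing Implicit Defensive.

Local Open Scope classical_set_scope.
Local Open Scope ring_scope.

Local Notation "x %:F" := (FracField.tofrac x).

Section Knots.
Variable R : realType.

(* The sphere S^3 as R^3 with one point at infinity. *)
Definition S3 : topologicalType := one_point_compactification 'rV[R]_3.

Definition in_S3 (A : set 'rV[R]_3) : set S3 := [set Some p | p in A].

Definition homeomorphism (f : S3 -> S3) : Prop :=
  continuous f /\ exists g, [/\ cancel f g, cancel g f & continuous g].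

Definition ambient_isotopic (A B : set S3) : Prop :=
  exists F : R -> S3 -> S3,
    [/\ {within `[0, 1] `*` setT, continuous (fun tx : R * S3 => F tx.1 tx.2)},
        forall t, t \in `[0, 1] -> homeomorphism (F t),
        forall x, F 0 x = x
      & F 1 @` A = B].

Definition edge_point (v : seq 'rV[R]_3) (i : nat) (t : R) : 'rV[R]_3 :=
  (1 - t) *: v`_i + t *: v`_(i.+1 %% size v).

Definition polygon (v : seq 'rV[R]_3) : set 'rV[R]_3 :=
  [set p | exists i t, [/\ (i < size v)%N, t \in `[0, 1[ & p = edge_point v i t]].

(* No point of the closed polygon with vertices [v] is run through twice. *)
Definition simple_polygon (v : seq 'rV[R]_3) : Prop :=
  (0 < size v)%N /\
  forall i j s t, (i < size v)%N -> (j < size v)%N ->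
    s \in `[0, 1[ -> t \in `[0, 1[ ->
    edge_point v i s = edge_point v j t -> i = j /\ s = t.

(* Knots are tame: isotopic to a simple closed polygon. *)
Definition knot (K : set S3) : Prop :=
  exists2 v, simple_polygon v & ambient_isotopic (in_S3 (polygon v)) K.

End Knots.

(* [(m, w)] is a word on [m] strands, numbered from 0; the letter [(i, b)] is
   the crossing of the strands in positions [i] and [i.+1], positive if [b]. *)
Definition braid : Type := (nat * seq (nat * bool))%type.

Definition is_braid (B : braid) : bool :=
  (0 < B.1)%N && all (fun l : nat * bool => (l.1.+1 < B.1)%N) B.2.

Section BraidClosure.
Variable R : realType.

Definition pt (x y z : R) : 'rV[R]_3 := \row_(i < 3) [:: x; y; z]`_i.

Fixpoint polyline (p : 'rV[R]_3) (s : seq 'rV[R]_3) : set 'rV[R]_3 :=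
  if s is r :: s' then
    [set (1 - t) *: p + t *: r | t in `[0, 1]] `|` polyline r s'
  else [set p].

(* The part of the braid in [t <= z <= t + 1], with upward strands in the plane
   [y = 0] except at the crossing. For the standard orientation of R^3, the
   crossing is positive when the strand going from [i] to [i.+1] is the one that
   passes through [y < 0]. *)
Definition braid_layer (m : nat) (t : nat) (l : nat * bool) : set 'rV[R]_3 :=
  let: (i, b) := l in
  let e : R := if b then -1 else 1 in
  [set p | exists j, [/\ (j < m)%N, j != i, j != i.+1 &
     polyline (pt j%:R 0 t%:R) [:: pt j%:R 0 t.+1%:R] p]]
  `|` polyline (pt i%:R 0 t%:R)
        [:: pt (i%:R + 2^-1) e (t%:R + 2^-1); pt i.+1%:R 0 t.+1%:R]
  `|` polyline (pt i.+1%:R 0 t%:R)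
        [:: pt (i%:R + 2^-1) (- e) (t%:R + 2^-1); pt i%:R 0 t.+1%:R].

(* Nested planar arcs to the right of the braid, joining the top [z = L] of
   each position to its bottom [z = 0]. *)
Definition closing_arc (m L j : nat) : set 'rV[R]_3 :=
  let h : R := (m - j)%:R in
  let x : R := (m + (m - j.+1))%:R in
  polyline (pt j%:R 0 L%:R)
    [:: pt j%:R 0 (L%:R + h); pt x 0 (L%:R + h); pt x 0 (- h);
        pt j%:R 0 (- h); pt j%:R 0 0].

Definition braid_closure (B : braid) : set 'rV[R]_3 :=
  let: (m, w) := B in
  [set p | exists2 t, (t < size w)%N & braid_layer m t (nth (0, true) w t) p]
  `|` [set p | exists2 j, (j < m)%N & closing_arc m (size w) j p].

End BraidClosure.

Definition qpoch (F : fieldType) (a q : F) (k : nat) : F :=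
  \prod_(j < k) (1 - a * q ^+ j).

Definition cxk (F : fieldType) (x q : F) (k : nat) : F :=
  x ^- k * qpoch (q * x) q k * qpoch (q^-1 * x) q^-1 k.

Notation Qq := {fraction {poly int}}.
Definition q : Qq := ('X)%:F.

Definition is_laurent : set Qq :=
  [set f | exists (p : {poly int}) (k : nat), f = p%:F / q ^+ k].

Record laurent := Laurent { laurent_val : Qq; laurentP : is_laurent laurent_val }.

Definition cnk (n k : nat) : Qq :=
  q ^ (- (k * n)%:Z) * qpoch (q ^+ n.+1) q k * qpoch (q ^ (n%:Z - 1)) q^-1 k.

Definition qbinom (n k : nat) : Qq :=
  qpoch q q n / (qpoch q q k * qpoch q q (n - k)).

(* Matrix entry, from [e_i (x) e_j] to [e_a (x) e_b], of the R-matrix (if [pos])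
   or of its inverse (if not) on the tensor square of the [n]-dimensional
   irreducible representation of quantum sl_2 with basis [e_0, ..., e_(n-1)],
   [e_0] of highest weight. The basis of the tensor powers is scaled, and the
   R-matrix divided by [q^((n - 1)^2 / 4)], so that all entries are in
   Z[q, q^-1]. *)
Definition Rmatrix (n : nat) (pos : bool) (i j a b : nat) : Qq :=
  if (i + j != a + b)%N then 0 else
  if pos then
    if (a < j)%N then 0 else
    let k := (a - j)%N in
    q ^ ((a * b)%:Z - (k * j)%:Z - (n%:Z - 1) * j%:Z) *
    qbinom a k * qpoch (q ^ (j%:Z - n%:Z + 1)) q k
  else
    if (b < i)%N then 0 else
    let k := (b - i)%N in
    (-1) ^+ k *
    q ^ ((n%:Z - 1) * b%:Z - (i * j)%:Z - (k * i)%:Z - 'C(k, 2)%:Z) *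
    qbinom b k * qpoch (q ^ (i%:Z - n%:Z + 1)) q k.

Section BraidRepresentation.
Variables n m : nat.
Implicit Types s t : m.-tuple 'I_n.

Definition label s (p : nat) : nat := nth 0%N [seq val i | i <- s] p.

Definition letter_entry (l : nat * bool) s t : Qq :=
  let p := l.1 in
  if [forall r : 'I_m,
        [|| r == p :> nat, r == p.+1 :> nat | tnth s r == tnth t r]]
  then Rmatrix n l.2 (label s p) (label s p.+1) (label t p) (label t p.+1)
  else 0.

Fixpoint word_entry (w : seq (nat * bool)) s t : Qq :=
  if w is l :: w' then \sum_r letter_entry l s r * word_entry w' r t
  else (s == t)%:R.

End BraidRepresentation.

Definition writhe (w : seq (nat * bool)) : int :=
  \sum_(l <- w) (if l.2 then 1 else -1).

(* Reshetikhin-Turaev invariant of the closure of a braid, zero-framed, divided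
   by its value at the unknot: position 0 is cut open and the other positions
   are closed by the quantum trace. The scalar in front collects the framing
   correction [q^(- (n^2 - 1) / 4)] and the factor [q^((n - 1)^2 / 4)] of each
   positive crossing, and the weight [q^((n - 1) / 2)] of each closed position;
   the division by 2 is exact when the closure is connected. With these
   conventions the left-handed trefoil has J_2 = q + q^3 - q^4. *)
Definition braid_jones (B : braid) (n : nat) : Qq :=
  let: (m, w) := B in
  q ^ (((n%:Z - 1) * (m%:Z - 1 - writhe w)) %/ 2)%Z *
  \sum_(s : m.-tuple 'I_n | label s 0 == 0%N)
     q ^- (\sum_(i <- s) i) * word_entry w s s.

(* Every knot is the closure of a braid (Alexander), and [braid_jones] does not
   depend on the braid. *)
Definition colored_jones (R : realType) (K : set (S3 R)) (n : nat) : Qq :=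
  braid_jones
    (xget (1%N, [::])
       [set B | is_braid B /\ ambient_isotopic (in_S3 (braid_closure B)) K]) n.

(* Terms with [n <= k] vanish, so this is the sum over all [k]. *)
Definition habiro_polynomials (R : realType) (K : set (S3 R))
    (H : nat -> laurent) : Prop :=
  forall n, (0 < n)%N ->
    colored_jones K n = \sum_(k < n) cnk n k * laurent_val (H k).

Definition is_subring (A : comNzRingType) (S : set A) : Prop :=
  [/\ S 1, forall f g, S f -> S g -> S (f - g)
     & forall f g, S f -> S g -> S (f * g)].

Definition coset (A : comNzRingType) (S : set A) (a f : A) : set A :=
  [set g | exists2 s, S s & g = f + a * s].

(* The limit of [S / a_n S], for [S] a subring of [A] and [a_n] dividing
   [a_(n+1)]: decreasing sequences of cosets. *)
Record invlim (A : comNzRingType) (S : set A) (a : nat -> A) := Invlim {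
  component :> nat -> set A;
  component_coset : forall n, exists2 f, S f & component n = coset S (a n) f;
  component_compat : forall n, component n.+1 `<=` component n }.

Section Series.
Variables (A : comNzRingType) (S T : set A) (a : nat -> A).

(* [T] contains [S], and [S / a_n S -> T / a_n T] is an isomorphism for
   every [n]. *)
Record series_spec : Prop := SeriesSpec {
  spec_subS : is_subring S;
  spec_subT : is_subring T;
  spec_incl : S `<=` T;
  spec_mem : forall n, S (a n);
  spec_dvd : forall n, exists2 s, S s & a n.+1 = a n * s;
  spec_surj : forall n t, T t -> exists s r, [/\ S s, T r & t = s + a n * r];
  spec_inj : forall n s r, S s -> T r -> s = a n * r ->
               exists2 r', S r' & s = a n * r' }.

Hypothesis spec : series_spec.
Variable u : nat -> A.
Hypothesis hu : forall k, T (u k).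

Definition series_component (n : nat) : set A :=
  S `&` coset T (a n) (\sum_(k < n) a k * u k).

Lemma subring0 (U : set A) : is_subring U -> U 0.
Proof. by case=> U1 UB _; rewrite -(subrr (1 : A)); exact: UB. Qed.

Lemma subringD (U : set A) f g : is_subring U -> U f -> U g -> U (f + g).
Proof.
move=> subU Uf Ug; have U0 := subring0 subU.
case: subU => _ UB _; rewrite -[g]opprK; apply: (UB) => //.
by rewrite -sub0r; exact: UB.
Qed.

Lemma subringM (U : set A) f g : is_subring U -> U f -> U g -> U (f * g).
Proof. by case=> _ _ UM; exact: UM. Qed.

Lemma subringB (U : set A) f g : is_subring U -> U f -> U g -> U (f - g).
Proof. by case=> _ UB _; exact: UB. Qed.

Lemma series_coset n :
  exists2 f, S f & series_component n = coset S (a n) f.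
Proof.
have [subS subT incl mem dvd surj inj] := spec.
have Tsum : T (\sum_(k < n) a k * u k).
  elim/big_ind: _ => [|f g Tf Tg|k _].
  - exact: subring0.
  - exact: subringD.
  - by apply: subringM => //; apply: incl.
have [s [r [Ss Tr Es]]] := surj n _ Tsum.
exists s => //; apply/seteqP; split => [g [Sg [t Tt Eg]]|g [t St ->]].
  have [||//|r' Sr' Er'] := inj n (g - s) (r + t).
  - exact: subringB.
  - exact: subringD.
  - by rewrite Eg Es; ring.
  by exists r' => //; rewrite -Er' addrC subrK.
split; first by apply: subringD => //; apply: subringM.
exists (t - r); first by apply: subringB => //; apply: incl.
by rewrite Es; ring.
Qed.

Lemma series_compat n : series_component n.+1 `<=` series_component n.
Proof.
have [subS subT incl mem dvd surj inj] := spec.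
move=> g [Sg [t Tt Eg]]; split=> //; rewrite Eg.
have [s Ss ->] := dvd n.
rewrite big_ord_recr /=; exists (u n + s * t).
  by apply: subringD => //; apply: subringM => //; exact: incl.
by rewrite mulrDr mulrA addrA.
Qed.

(* The sum of the [a_k u_k], as an element of the limit. *)
Definition series : invlim S a := Invlim series_coset series_compat.

End Series.

Definition is_poly : set Qq := [set f | exists p : {poly int}, f = p%:F].

Lemma tofracX_neq0 (F : idomainType) : ('X : {poly F})%:F != 0.
Proof. by rewrite tofrac_eq0 polyX_eq0. Qed.

Lemma q_neq0 : q != 0. Proof. exact: tofracX_neq0. Qed.

Lemma is_poly_subring : is_subring is_poly.
Proof.
split; first by exists 1; rewrite tofrac1.
- by move=> _ _ [p ->] [r ->]; exists (p - r); rewrite tofracB.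
- by move=> _ _ [p ->] [r ->]; exists (p * r); rewrite tofracM.
Qed.

Section FieldIdentities.
Variable F : fieldType.
Implicit Types c d u v x y r g s h : F.

Lemma subr_frac c d u v :
  u != 0 -> v != 0 -> (c * v - d * u) / (u * v) = c / u - d / v.
Proof. by move=> u0 v0; field; rewrite u0 v0. Qed.

Lemma mulr_frac c d u v :
  u != 0 -> v != 0 -> (c * d) / (u * v) = (c / u) * (d / v).
Proof. by move=> u0 v0; field; rewrite u0 v0. Qed.

Lemma bezout_frac c r g u v :
  u != 0 -> 1 = v * r + u * g -> c / u = c * g + v * (c / u * r).
Proof.
move=> u0 E; rewrite -[LHS]mulr1 {}E.
by field; rewrite u0.
Qed.

Lemma bezout_mul c r g s u v :
  u != 0 -> 1 = v * r + u * g -> s = v * (c / u) -> s = v * (s * r + c * g).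
Proof.
move=> u0 E Es; rewrite -[LHS]mulr1 {1}E mulrDr {2}Es.
by field; rewrite u0.
Qed.

Lemma bezout_step u v g h r x :
  1 = v * r + u * h -> v = 1 - x * g ->
  1 = v * (r + u * h) + (x * u) * (g * h).
Proof. by move=> E Ev; rewrite {1}E Ev; ring. Qed.

Lemma qpoch_step x g u : (1 - x * g) * (1 - x * u) = 1 - x * (g + u - x * g * u).
Proof. by ring. Qed.

Lemma cxk_step x c n : x != 0 -> c != 0 ->
  cxk x c n.+1 = cxk x c n * (x + x^-1 - c ^+ n.+1 - c ^- n.+1).
Proof.
move=> x0 c0; rewrite /cxk /qpoch !big_ord_recr /= exprVn exprSr.
rewrite -mulrA [in RHS]exprS; set u := \prod_(j < n) _; set v := \prod_(j < n) _.
by field; rewrite ?x0 ?c0 ?expf_neq0.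
Qed.

End FieldIdentities.

Lemma is_laurent_subring : is_subring is_laurent.
Proof.
have q0 := q_neq0.
split; first by exists 1, 0%N; rewrite tofrac1 expr0 divr1.
- move=> _ _ [p [k ->]] [r [l ->]].
  exists (p * 'X^l - r * 'X^k), (k + l)%N.
  by rewrite tofracB !tofracM !tofracXn -/q exprD subr_frac ?expf_neq0.
- move=> _ _ [p [k ->]] [r [l ->]].
  exists (p * r), (k + l)%N; by rewrite tofracM exprD mulr_frac ?expf_neq0.
Qed.

Lemma is_laurent_poly : is_poly `<=` is_laurent.
Proof. by move=> _ [p ->]; exists p, 0%N; rewrite expr0 divr1. Qed.

Lemma is_laurent_q : is_laurent q.
Proof. by apply: is_laurent_poly; exists 'X. Qed.

Lemma is_laurent_qV : is_laurent q^-1.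
Proof. by exists 1, 1%N; rewrite tofrac1 expr1 div1r. Qed.

Lemma subringX (A : comNzRingType) (U : set A) f n :
  is_subring U -> U f -> U (f ^+ n).
Proof.
move=> subU Uf; elim: n => [|n IH]; first by case: subU.
by rewrite exprS; exact: subringM.
Qed.

Lemma subring_qpoch (F : fieldType) (U : set F) (a b : F) k :
  is_subring U -> U a -> U b -> U (qpoch a b k).
Proof.
move=> subU Ua Ub; rewrite /qpoch.
elim/big_ind: _ => [|f g|i _]; [by case: subU|exact: subringM|].
apply: subringB => //; first by case: subU.
by apply: subringM => //; exact: subringX.
Qed.

Lemma subringXz (F : fieldType) (U : set F) f (m : int) :
  is_subring U -> U f -> U f^-1 -> U (f ^ m).
Proof.
by move=> subU Uf UV; case: m => n; rewrite ?NegzE -?exprnN -?exprVn;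
  exact: subringX.
Qed.

Lemma qpochS (F : fieldType) (a b : F) k :
  qpoch a b k.+1 = qpoch a b k * (1 - a * b ^+ k).
Proof. by rewrite /qpoch big_ord_recr. Qed.

(* [q] is invertible modulo [(q; q)_n]. *)
Lemma qpoch_bezout n k :
  exists r g, [/\ is_poly r, is_poly g & 1 = qpoch q q n * r + q ^+ k * g].
Proof.
have subP := is_poly_subring.
have P1 : is_poly 1 by case: subP.
have Pq : is_poly q by exists 'X.
have [g Pg Eg] : exists2 g, is_poly g & qpoch q q n = 1 - q * g.
  elim: n => [|n [g Pg IH]].
    exists 0; first exact: subring0.
    by rewrite /qpoch big_ord0 mulr0 subr0.
  exists (g + q ^+ n - q * g * q ^+ n); last by rewrite qpochS IH qpoch_step.
  by apply: subringB => //; [apply: subringD|apply: subringM] => //;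
     do ?[exact: subringX|exact: subringM].
elim: k => [|k [r [h [Pr Ph E]]]].
  exists 0, 1; split => //; first exact: subring0.
  by rewrite mulr0 add0r expr0 mulr1.
exists (r + q ^+ k * h), (g * h); split.
- by apply: subringD => //; apply: subringM => //; exact: subringX.
- exact: subringM.
- by rewrite exprS; exact: bezout_step.
Qed.

Lemma habiro_spec : series_spec is_poly is_laurent (qpoch q q).
Proof.
have subP := is_poly_subring.
have Pq : is_poly q by exists 'X.
split => //; do ?[exact: is_laurent_subring|exact: is_laurent_poly].
- by move=> n; exact: subring_qpoch.
- move=> n; exists (1 - q * q ^+ n); last exact: qpochS.
  by apply: subringB => //; [case: subP|apply: subringM => //; exact: subringX].
- move=> n _ [p [k ->]].
  have [r [g [Pr Pg E]]] := qpoch_bezout n k.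
  exists (p%:F * g), (p%:F / q ^+ k * r); split.
  + by apply: subringM => //; exists p.
  + apply: subringM; first exact: is_laurent_subring.
      by exists p, k.
    exact: is_laurent_poly.
  + by apply: bezout_frac => //; rewrite expf_neq0 ?q_neq0.
- move=> n s _ Ps [p [k ->]] Es.
  have [r [g [Pr Pg E]]] := qpoch_bezout n k.
  exists (s * r + p%:F * g).
    by apply: subringD => //; apply: subringM => //; exists p.
  by apply: bezout_mul Es => //; rewrite expf_neq0 ?q_neq0.
Qed.

Definition habiro_ring : Type := invlim is_poly (qpoch q q).

Lemma DJ_subproof (H : nat -> laurent) (m : int) (k : nat) :
  is_laurent (qpoch q^-1 q^-1 k * laurent_val (H k) * q ^ (k%:Z * m)).
Proof.
have subL := is_laurent_subring; have qL := is_laurent_q.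
have qV := is_laurent_qV.
apply: subringM => //; last exact: subringXz.
by apply: subringM => //; [exact: subring_qpoch|exact: laurentP].
Qed.

Definition DJ (H : nat -> laurent) (m : int) : habiro_ring :=
  series habiro_spec (DJ_subproof H m).

(* Only for [0 < n], where the terms with [n <= k] vanish; [DJ_0] is [DJ]. *)
Definition DJn (H : nat -> laurent) (m : int) (n : nat) : Qq :=
  \sum_(k < n) cnk n k * laurent_val (H k) * q ^ (k%:Z * m).

Lemma cnk0 k : cnk 0 k = qpoch q q k * qpoch q^-1 q^-1 k.
Proof. by rewrite /cnk muln0 expr0z mul1r expr1. Qed.

(* All complex roots of unity are algebraic. *)
Record unity_root := UnityRoot {
  zeta_val : algC;
  zetaP : exists2 N, (0 < N)%N & zeta_val ^+ N = 1 }.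

Definition ev (z : unity_root) (f : Qq) : algC :=
  xget 0 [set c | exists (p : {poly int}) (k : nat),
    f = p%:F / q ^+ k /\
    c = (map_poly intr p).[zeta_val z] / zeta_val z ^+ k].

(* The component of index [n] can be evaluated at [z] when [(q; q)_n] vanishes
   at [z]. *)
Definition habiro_eval (z : unity_root) (F : habiro_ring) : algC :=
  xget 0 [set c | exists n f, [/\ qpoch (zeta_val z) (zeta_val z) n = 0,
    component F n f & c = ev z f]].

Definition is_cyclotomic (z : unity_root) : set algC :=
  [set c | exists p : {poly int}, c = (map_poly intr p).[zeta_val z]].

Lemma zeta_neq0 z : zeta_val z != 0.
Proof.
case: (zetaP z) => N N0 E; apply/eqP => z0.
by move: E; rewrite z0 expr0n gtn_eqF // => /eqP; rewrite eq_sym oner_eq0.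
Qed.

Lemma ev_laurent z (p : {poly int}) k :
  ev z (p%:F / q ^+ k) = (map_poly intr p).[zeta_val z] / zeta_val z ^+ k.
Proof.
rewrite /ev; set P := [set c | _].
have [r [l [E ->]]] : P (xget 0 P) by apply: xgetPex; eexists; exists p, k.
have Epr : p * 'X^l = r * 'X^k.
  apply/eqP; rewrite -tofrac_eq !tofracM !tofracXn -/q; apply/eqP.
  have qk : q ^+ k != 0 by rewrite expf_neq0 ?q_neq0.
  have ql : q ^+ l != 0 by rewrite expf_neq0 ?q_neq0.
  by rewrite -[p%:F](mulfVK qk) [p%:F * _]E mulrAC mulfVK // mulrAC.
have z0 := zeta_neq0 z.
have := congr1 (fun s : {poly int} => (map_poly (intr : int -> algC) s).[zeta_val z]) Epr.
rewrite /= !rmorphM /= !map_polyXn !hornerM !hornerXn => E2.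
apply/eqP; rewrite eqr_div ?expf_neq0 //; exact/eqP.
Qed.

Lemma is_cyclotomic_subring z : is_subring (is_cyclotomic z).
Proof.
split; first by exists 1; rewrite rmorph1 hornerC.
- by move=> _ _ [p ->] [r ->]; exists (p - r); rewrite rmorphB hornerD hornerN.
- by move=> _ _ [p ->] [r ->]; exists (p * r); rewrite rmorphM hornerM.
Qed.

Lemma is_cyclotomic_zeta z : is_cyclotomic z (zeta_val z).
Proof. by exists 'X; rewrite map_polyX hornerX. Qed.

Lemma is_cyclotomic_zetaV z : is_cyclotomic z (zeta_val z)^-1.
Proof.
case: (zetaP z) => [[//|N]] _ E; exists 'X^N.
rewrite map_polyXn hornerXn.
by apply: (mulfI (zeta_neq0 z)); rewrite -exprS E divff ?zeta_neq0.
Qed.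

Lemma is_cyclotomic_eval z (f : laurent) :
  is_cyclotomic z (ev z (laurent_val f)).
Proof.
case: f => /= _ [p [k ->]]; rewrite ev_laurent -exprVn.
apply: subringM; first exact: is_cyclotomic_subring.
- by exists p.
- by apply: subringX; [exact: is_cyclotomic_subring|exact: is_cyclotomic_zetaV].
Qed.

Section ColoredHabiro.
Variables (C : fieldType) (C0 : set C) (b : C).
Hypotheses (subC0 : is_subring C0) (b0 : b != 0) (C0b : C0 b) (C0bV : C0 b^-1).

Local Notation "c %:C" := ((c%:P)%:F : {fraction {poly C}})
  (at level 1, format "c %:C").

Definition xvar : {fraction {poly C}} := ('X)%:F.

(* The ring [C0[x + x^-1 - 2]], inside [C(x)]. *)
Definition in_xring : set {fraction {poly C}} :=
  [set f | exists2 P : {poly C}, forall i, C0 P`_i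
    & f = (map_poly (fun c => c%:C) P).[xvar + xvar^-1 - 2]].

(* The limit of the quotients of [C0[x + x^-1 - 2]] by [c_n(x, b)]. *)
Definition colored_habiro_ring : Type := invlim in_xring (cxk xvar b%:C).

Let toC : {rmorphism C -> {fraction {poly C}}} :=
  (@FracField.tofrac {poly C}) \o polyC.

Lemma in_xringE : in_xring = [set f | exists2 P : {poly C}, forall i, C0 P`_i
    & f = (map_poly toC P).[xvar + xvar^-1 - 2]].
Proof. by []. Qed.

Lemma in_xring_subring : is_subring in_xring.
Proof.
rewrite in_xringE; split.
- exists 1; last by rewrite rmorph1 hornerC.
  move=> i; rewrite coef1; case: (i == 0%N); first by case: subC0.
  exact: subring0.
- move=> _ _ [P CP ->] [Q CQ ->]; exists (P - Q).
    by move=> i; rewrite coefB; exact: subringB.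
  by rewrite rmorphB hornerD hornerN.
- move=> _ _ [P CP ->] [Q CQ ->]; exists (P * Q); last by rewrite rmorphM hornerM.
  move=> i; rewrite coefM; elim/big_ind: _ => [|f g|j _].
  + exact: subring0.
  + exact: subringD.
  + exact: subringM.
Qed.

Lemma in_xring_const c : C0 c -> in_xring c%:C.
Proof.
move=> Cc; exists c%:P; last by rewrite (map_polyC toC) hornerC.
by move=> i; rewrite coefC; case: (i == 0%N) => //; exact: subring0.
Qed.

Lemma in_xring_var : in_xring (xvar + xvar^-1 - 2).
Proof.
exists 'X; last by rewrite (map_polyX toC) hornerX.
move=> i; rewrite coefX; case: (i == 1%N); first by case: subC0.
exact: subring0.
Qed.

Lemma cxkS n : cxk xvar b%:C n.+1 =
  cxk xvar b%:C n * (xvar + xvar^-1 - (b ^+ n.+1)%:C - (b^-1 ^+ n.+1)%:C).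
Proof.
have x0 : xvar != 0 by exact: tofracX_neq0.
have bC0 : b%:C != 0 by rewrite tofrac_eq0 polyC_eq0.
have EX k : (b ^+ k)%:C = b%:C ^+ k by exact: (rmorphXn toC).
have EV k : (b^-1 ^+ k)%:C = b%:C ^- k.
  have EbV : b^-1%:C = b%:C^-1 by exact: (fmorphV toC).
  by rewrite -exprVn -EbV; exact: (rmorphXn toC).
rewrite EX EV.
have E := cxk_step n x0 bC0; exact: E.
Qed.

Lemma colored_habiro_spec : series_spec in_xring in_xring (cxk xvar b%:C).
Proof.
have subX := in_xring_subring.
have step n : in_xring (xvar + xvar^-1 - (b ^+ n.+1)%:C - (b^-1 ^+ n.+1)%:C).
  rewrite -[xvar + _](subrK 2); apply: subringB => //.
    apply: subringB => //; last by apply: in_xring_const; exact: subringX.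
    apply: subringD => //; first exact: in_xring_var.
    by have X1 : in_xring 1; [case: subX|apply: subringD].
  by apply: in_xring_const; exact: subringX.
split => //.
- elim=> [|n IH]; last by rewrite cxkS; exact: subringM.
  by rewrite /cxk expr0 invr1 /qpoch !big_ord0 !mulr1; case: subX.
- by move=> n; eexists; last exact: cxkS.
- move=> n t Xt; exists t, 0; split => //; first exact: subring0.
  by rewrite mulr0 addr0.
- by move=> n s r _ Xr ->; exists r.
Qed.

Variable h : nat -> C.
Hypothesis C0h : forall k, C0 (h k).

Lemma DJx_subproof (m : int) (k : nat) : in_xring (h k * b ^ (k%:Z * m))%:C.
Proof. by apply: in_xring_const; apply: subringM => //; exact: subringXz. Qed.

Definition DJx_series (m : int) : colored_habiro_ring :=
  series colored_habiro_spec (DJx_subproof m).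

End ColoredHabiro.

Definition DJx (H : nat -> laurent) (m : int) :
    colored_habiro_ring is_laurent q :=
  DJx_series is_laurent_subring q_neq0 is_laurent_q is_laurent_qV
    (fun k => laurentP (H k)) m.

Definition DJx_zeta (H : nat -> laurent) (m : int) (z : unity_root) :
    colored_habiro_ring (is_cyclotomic z) (zeta_val z) :=
  DJx_series (is_cyclotomic_subring z) (zeta_neq0 z) (is_cyclotomic_zeta z)
    (is_cyclotomic_zetaV z) (fun k => is_cyclotomic_eval z (H k)) m.

(* Main.v *)
(* Each family determines the Habiro polynomials H_k, hence all the others.
   - The J_n determine them because the matrix (c_{n,k}) is triangular with
     nonzero entries for k < n, and J_n is determined by its values at the
     roots of unity.
   - DJ^(m)(x, q) determines them for any single m, because
     c_{k+1} = c_k (x + 1/x - q^(k+1) - q^(-k-1)): if k is the first index at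
     which two sequences differ, x + 1/x - q^(k+1) - q^(-k-1) divides a nonzero
     constant in a polynomial ring in the variable x + 1/x - 2, which is absurd.
     The same holds at q = zeta.
   - At a primitive N-th root of unity zeta, DJ^(m)(zeta) is a sum over k < N
     with nonzero coefficients times H_k(zeta) zeta^(k m), so by Fourier
     inversion in m these values determine H_k(zeta) whenever k < N, and a
     Laurent polynomial is determined by its values at infinitely many zeta. *)
Require Import Defs.
From mathcomp Require Import all_boot all_order all_algebra.
From mathcomp Require Import fraction algC cyclotomic.
From mathcomp Require Import all_classical all_reals topology.
From mathcomp Require Import ring.
Import Order.TTheory GRing.Theory Num.Theory.
Set Implicit Arguments.
Unset Strict Implicit.
Unset Printing Implicit Defensive.
Local Open Scope classical_set_scope.
Local Open Scope ring_scope.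

Local Notation "x %:F" := (FracField.tofrac x).

(** * Evaluation of Laurent polynomials at a root of unity *)

Section Evaluation.
Variable z : unity_root.
Implicit Types f g : Qq.
Local Notation zeta := (zeta_val z).

Lemma ev_poly (p : {poly int}) : ev z p%:F = (map_poly intr p).[zeta].
Proof. by have := ev_laurent z p 0; rewrite !expr0 !divr1. Qed.

Lemma ev_q : ev z q = zeta.
Proof. by rewrite ev_poly map_polyX hornerX. Qed.

Lemma ev_qV : ev z q^-1 = zeta^-1.
Proof.
have := ev_laurent z 1 1.
by rewrite tofrac1 !div1r !expr1 rmorph1 hornerC mul1r.
Qed.

Lemma ev1 : ev z 1 = 1.
Proof. by rewrite -tofrac1 ev_poly rmorph1 hornerC. Qed.

Lemma evB f g :
  is_laurent f -> is_laurent g -> ev z (f - g) = ev z f - ev z g.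
Proof.
move=> [p [k ->]] [r [l ->]].
have q0 n : q ^+ n != 0 by rewrite expf_neq0 ?q_neq0.
have z0 n : zeta ^+ n != 0 by rewrite expf_neq0 ?zeta_neq0.
have -> : p%:F / q ^+ k - r%:F / q ^+ l =
    (p * 'X^l - r * 'X^k)%:F / q ^+ (k + l).
  by rewrite tofracB !tofracM !tofracXn -/q exprD subr_frac.
rewrite !ev_laurent rmorphB !rmorphM /=.
by rewrite !map_polyXn hornerD hornerN !hornerM !hornerXn exprD subr_frac.
Qed.

Lemma evM f g :
  is_laurent f -> is_laurent g -> ev z (f * g) = ev z f * ev z g.
Proof.
move=> [p [k ->]] [r [l ->]].
have q0 n : q ^+ n != 0 by rewrite expf_neq0 ?q_neq0.
have z0 n : zeta ^+ n != 0 by rewrite expf_neq0 ?zeta_neq0.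
have -> : p%:F / q ^+ k * (r%:F / q ^+ l) = (p * r)%:F / q ^+ (k + l).
  by rewrite tofracM exprD mulr_frac.
rewrite !ev_laurent rmorphM /=.
by rewrite hornerM exprD mulr_frac.
Qed.

Lemma ev0 : ev z 0 = 0.
Proof.
by rewrite -(subrr 1) evB ?subrr //; case: is_laurent_subring.
Qed.

Lemma evD f g :
  is_laurent f -> is_laurent g -> ev z (f + g) = ev z f + ev z g.
Proof.
move=> Lf Lg; have subL := is_laurent_subring; have L0 := subring0 subL.
rewrite -[X in f + X]opprK -[- g]sub0r !evB //; last exact: subringB.
by rewrite ev0 sub0r opprK.
Qed.

Lemma ev_sum n (F : nat -> Qq) : (forall k, is_laurent (F k)) ->
  ev z (\sum_(k < n) F k) = \sum_(k < n) ev z (F k).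
Proof.
move=> LF; have subL := is_laurent_subring.
elim: n => [|n IH]; first by rewrite !big_ord0 ev0.
rewrite !big_ord_recr /= evD ?IH //.
by elim/big_ind: _ => // [|? ?]; [exact: subring0 | exact: subringD].
Qed.

Lemma evX f n : is_laurent f -> ev z (f ^+ n) = ev z f ^+ n.
Proof.
move=> Lf; have subL := is_laurent_subring.
elim: n => [|n IH]; first by rewrite !expr0 ev1.
by rewrite !exprS evM ?IH //; exact: subringX.
Qed.

Lemma ev_qpoch f g n : is_laurent f -> is_laurent g ->
  ev z (qpoch f g n) = qpoch (ev z f) (ev z g) n.
Proof.
move=> Lf Lg; have subL := is_laurent_subring.
have L1 : is_laurent 1 by case: subL.
elim: n => [|n IH]; first by rewrite /qpoch !big_ord0 ev1.
have Lfg : is_laurent (f * g ^+ n) by apply: subringM => //; exact: subringX.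
rewrite !qpochS evM; [|exact: subring_qpoch|exact: subringB].
by rewrite IH evB // ev1 evM ?evX //; exact: subringX.
Qed.

Lemma ev_qXz (m : int) : ev z (q ^ m) = zeta ^ m.
Proof.
case: m => n; first by rewrite evX ?ev_q //; exact: is_laurent_q.
by rewrite NegzE -!exprnN -!exprVn evX ?ev_qV //; exact: is_laurent_qV.
Qed.

End Evaluation.

(** * Laurent polynomials determined by their values at roots of unity *)

Lemma prim_unity_root N : (0 < N)%N ->
  exists z : unity_root, N.-primitive_root (zeta_val z).
Proof.
move=> N0; have [x px] := C_prim_root_exists N0.
have hx : exists2 M, (0 < M)%N & x ^+ M = 1 by exists N; rewrite ?(prim_expr_order px).
by exists (UnityRoot hx).
Qed.

(** A nonzero polynomial has finitely many roots, whereas each order above [M] provides a new one.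
    The bound [M] serves [habiro_eval_inj], where the values of [H k] are recovered at orders above
    [k]. *)
Lemma laurent_eq0 f (M : nat) : is_laurent f ->
  (forall (z : unity_root) N, (M < N)%N -> N.-primitive_root (zeta_val z) ->
     ev z f = 0) ->
  f = 0.
Proof.
move=> [p [k ->]] hz.
have [->|p0] := eqVneq p 0; first by rewrite tofrac0 mul0r.
pose P : {poly algC} := map_poly intr p.
have P0 : P != 0 by rewrite map_poly_eq0_id0 // intr_eq0 lead_coef_eq0.
(* [w N] has order [N + 1], so the indices from [M] on give the orders above [M]. *)
pose w N := zeta_val (projT1 (cid (prim_unity_root (ltn0Sn N)))).
have wP N : N.+1.-primitive_root (w N).
  by rewrite /w; case: cid.
pose s := [seq w i | i <- iota M (size P)].
have us : uniq s.
  (* If two of these roots coincide, their orders divide each other. *)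
  rewrite map_inj_uniq ?iota_uniq // => i j Eij.
  apply/eqP; rewrite -eqSS eqn_dvd (prim_order_dvd (wP i)) Eij.
  by rewrite (prim_order_dvd (wP j)) -{2}Eij !prim_expr_order ?eqxx.
have rs : all (root P) s.
  apply/allP => x /mapP[N]; rewrite mem_iota => /andP[MN _] ->.
  have := hz _ N.+1 MN (wP N); rewrite ev_laurent => /eqP.
  by rewrite mulf_eq0 invr_eq0 expf_eq0 (negPf (zeta_neq0 _)) andbF orbF.
have := max_poly_roots P0 rs us.
by rewrite size_map size_iota ltnn.
Qed.

Lemma laurent_inj : injective laurent_val.
Proof.
case=> f Lf [g Lg] /= E; subst g.
by rewrite (Prop_irrelevance Lf Lg).
Qed.

Lemma laurent_ev_inj (M : nat) (f g : laurent) :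
  (forall (z : unity_root) N, (M < N)%N -> N.-primitive_root (zeta_val z) ->
     ev z (laurent_val f) = ev z (laurent_val g)) ->
  f = g.
Proof.
move=> hfg; apply: laurent_inj; apply/eqP; rewrite -subr_eq0; apply/eqP.
have subL := is_laurent_subring; have Lf := laurentP f; have Lg := laurentP g.
apply: (@laurent_eq0 _ M); first exact: subringB.
by move=> z N MN pz; rewrite evB // (hfg z N) ?subrr.
Qed.

(** * Nonvanishing and triangularity of the coefficients [cnk] *)

Lemma qpoch_neq0 (F : fieldType) (a b : F) n :
  (forall j, (j < n)%N -> a * b ^+ j != 1) -> qpoch a b n != 0.
Proof.
move=> ab; apply/prodf_neq0 => j _.
by rewrite subr_eq0 eq_sym; exact: ab.
Qed.

Lemma q_exp_neq1 n : (0 < n)%N -> q ^+ n != 1.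
Proof.
move=> n0; rewrite -tofracXn -tofrac1 tofrac_eq.
apply/eqP => /(congr1 (fun p : {poly int} => p.[0])) /eqP.
by rewrite hornerXn hornerC expr0n gtn_eqF.
Qed.

Lemma qpoch_exp_neq0 (F : fieldType) (x : F) n k :
  (forall j, (0 < j)%N -> x ^+ j != 1) -> qpoch (x ^+ n.+1) x k != 0.
Proof. by move=> hx; apply: qpoch_neq0 => j _; rewrite -exprD hx. Qed.

(** The factors are [1 - x^(n - 1 - j)] with [j < k < n], so every exponent is positive. *)
Lemma qpochV_exp_neq0 (F : fieldType) (x : F) n k : x != 0 ->
  (forall j, (0 < j)%N -> x ^+ j != 1) -> (k < n)%N ->
  qpoch (x ^ (n%:Z - 1)) x^-1 k != 0.
Proof.
move=> x0 hx; case: n => // n kn; apply: qpoch_neq0 => j jk.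
have jn : (j < n)%N by exact: leq_trans jk _.
have -> : n.+1%:Z - 1 = (n - j)%N%:Z + j%:Z.
  by rewrite -PoszD subnK 1?ltnW // -addn1 PoszD addrK.
rewrite expfzDr // exprVn -mulrA mulfV ?expf_neq0 // mulr1.
by rewrite hx // subn_gt0.
Qed.

Lemma cnk_neq0 n k : (k < n)%N -> cnk n k != 0.
Proof.
move=> kn; rewrite mulf_neq0 //; last first.
  exact: qpochV_exp_neq0 q_neq0 q_exp_neq1 kn.
apply: mulf_neq0; first exact: expfz_neq0 q_neq0.
exact: qpoch_exp_neq0 q_exp_neq1.
Qed.

Lemma cnk_laurent n k : is_laurent (cnk n k).
Proof.
have subL := is_laurent_subring.
have Lq := is_laurent_q; have LqV := is_laurent_qV.
apply: subringM => //; [apply: subringM => //|]; first exact: subringXz.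
- by apply: subring_qpoch => //; exact: subringX.
- by apply: subring_qpoch => //; exact: subringXz.
Qed.

Lemma cnk_sum_laurent (H : nat -> laurent) n :
  is_laurent (\sum_(k < n) cnk n k * laurent_val (H k)).
Proof.
have subL := is_laurent_subring.
elim/big_ind: _ => [|f g Lf Lg|k _]; first exact: subring0.
- exact: subringD.
- by apply: subringM => //; [exact: cnk_laurent|exact: laurentP].
Qed.

(** In the equation for [n = k + 1] the term of index [k] comes last and has a nonzero coefficient,
    so strong induction determines [h k] from the earlier values. *)
Lemma cnk_sum_inj (h h' : nat -> Qq) :
  (forall n, (0 < n)%N ->
     \sum_(k < n) cnk n k * h k = \sum_(k < n) cnk n k * h' k) ->
  h =1 h'.
Proof.
move=> E; elim/ltn_ind => k IH; have := E k.+1 isT.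
rewrite !big_ord_recr /= (eq_bigr (fun i : 'I_k => cnk k.+1 i * h' i)).
  by move/addrI/(mulfI (cnk_neq0 (ltnSn k))).
by move=> i _; rewrite IH.
Qed.

(** * Primitive roots: finite Fourier inversion and evaluation in the Habiro ring *)

Section PrimitiveRoot.
Variables (F : fieldType) (N : nat) (x : F).
Hypothesis px : N.-primitive_root x.

Lemma prim_exp_neq1 j : (0 < j < N)%N -> x ^+ j != 1.
Proof.
by case/andP=> j0 jN; rewrite -(prim_order_dvd px) gtnNdvd.
Qed.

Lemma qpoch_prim_neq0 k : (k < N)%N -> qpoch x x k != 0.
Proof.
move=> kN; apply: qpoch_neq0 => j jk.
by rewrite -exprS prim_exp_neq1 // (leq_ltn_trans jk).
Qed.

Lemma qpochV_prim_neq0 k : (k < N)%N -> qpoch x^-1 x^-1 k != 0.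
Proof.
move=> kN; apply: qpoch_neq0 => j jk.
by rewrite -exprS exprVn invr_eq1 prim_exp_neq1 // (leq_ltn_trans jk).
Qed.

Lemma qpoch_prim_eq0 k : (N <= k)%N -> qpoch x x k = 0.
Proof.
have N0 := prim_order_gt0 px; move=> Nk.
have jk : (N.-1 < k)%N by rewrite prednK.
apply/eqP/prodf_eq0; exists (Ordinal jk) => //=.
by rewrite -exprS prednK // (prim_expr_order px) subrr.
Qed.

(** By linearity the hypothesis extends from monomials to all polynomials evaluated at the powers of
    [x]. A polynomial vanishing at every [x^i] with [i <> k] then isolates [a k]. *)
Lemma prim_fourier_inj (a : nat -> F) :
  (forall m, \sum_(k < N) a k * x ^+ (k * m) = 0) ->
  forall k, (k < N)%N -> a k = 0.
Proof.
move=> Ea k kN.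
have EP (P : {poly F}) : \sum_(i < N) a i * P.[x ^+ i] = 0.
  under eq_bigr do rewrite horner_coef mulr_sumr.
  rewrite exchange_big big1 //= => j _.
  under eq_bigr do rewrite mulrCA -exprM.
  by rewrite -mulr_sumr Ea mulr0.
have := EP (\prod_(i < N | i != Ordinal kN) ('X - (x ^+ i)%:P)).
rewrite (bigD1 (Ordinal kN)) //= [X in _ + X]big1 ?addr0; last first.
  move=> i ik; rewrite horner_prod (bigD1 i) //=.
  by rewrite hornerXsubC subrr mul0r mulr0.
move/eqP; rewrite mulf_eq0 => /orP[/eqP //|].
(* The remaining case would give [x^i = x^k] with distinct exponents below [N]. *)
rewrite horner_prod => /prodf_eq0[i ik].
rewrite hornerXsubC subr_eq0 (eq_prim_root_expr px) !modn_small //.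
by move/eqP => E; case/eqP: ik; apply: val_inj; rewrite /= E.
Qed.

End PrimitiveRoot.

(** At a root of order [N], [(q; q)_n] vanishes exactly when [N <= n]. For such [n] the ambiguity
    modulo [(q; q)_n] and the terms of index at least [N] all evaluate to zero, so the value is the
    same for every admissible component. *)
Lemma habiro_eval_DJ (H : nat -> laurent) m z N :
  N.-primitive_root (zeta_val z) ->
  habiro_eval z (DJ H m) =
  \sum_(k < N) qpoch (zeta_val z) (zeta_val z) k *
    (qpoch (zeta_val z)^-1 (zeta_val z)^-1 k * ev z (laurent_val (H k)) *
     zeta_val z ^ (k%:Z * m)).
Proof.
move=> pz; set S := \sum_(k < N) _.
have subL := is_laurent_subring.
have Lq := is_laurent_q; have LqV := is_laurent_qV.
have key n f : qpoch (zeta_val z) (zeta_val z) n = 0 ->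
    component (DJ H m) n f -> ev z f = S.
  move=> zn [_ [t Lt ->]].
  have Nn : (N <= n)%N.
    by rewrite leqNgt; apply/negP => /(qpoch_prim_neq0 pz); rewrite zn eqxx.
  pose u k := qpoch q q k *
    (qpoch q^-1 q^-1 k * laurent_val (H k) * q ^ (k%:Z * m)).
  have Lqn k : is_laurent (qpoch q q k) by exact: subring_qpoch.
  have LqVn k : is_laurent (qpoch q^-1 q^-1 k) by exact: subring_qpoch.
  have Lu k : is_laurent (u k) by apply: subringM => //; exact: DJ_subproof.
  have Lsum : is_laurent (\sum_(k < n) u k).
    by elim/big_ind: _ => [|f1 g1|k]; [exact: subring0|exact: subringD|].
  rewrite evD //; last exact: subringM.
  rewrite evM // ev_qpoch // ev_q zn mul0r addr0.
  rewrite [LHS](@ev_sum z n u Lu).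
  rewrite /S (big_ord_widen_cond _ predT (fun k =>
    qpoch (zeta_val z) (zeta_val z) k *
    (qpoch (zeta_val z)^-1 (zeta_val z)^-1 k * ev z (laurent_val (H k)) *
     zeta_val z ^ (k%:Z * m))) Nn) big_mkcond [RHS]big_mkcond /=.
  apply: eq_bigr => k _.
  have -> : ev z (u k) = qpoch (zeta_val z) (zeta_val z) k *
    (qpoch (zeta_val z)^-1 (zeta_val z)^-1 k * ev z (laurent_val (H k)) *
     zeta_val z ^ (k%:Z * m)).
    have LH := laurentP (H k).
    have Lqz : is_laurent (q ^ (k%:Z * m)) by exact: subringXz.
    have LqH : is_laurent (qpoch q^-1 q^-1 k * laurent_val (H k)).
      exact: subringM.
    rewrite !evM //; last exact: subringM.
    by rewrite !ev_qpoch // ev_q ev_qV ev_qXz.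
  case: ltnP => // Nk; by rewrite (qpoch_prim_eq0 pz Nk) mul0r.
rewrite /habiro_eval; set P := [set c | _].
have [n [f [zn hf ->]]] : P (xget 0 P); last exact: (key n).
apply: xgetPex.
(* The choice made by [xget] is not its default: the component of index [N] can be evaluated and
   contains the representative [f] of its coset. *)
have [f Pf Ef] := component_coset (DJ H m) N.
exists (ev z f), N, f; split; [exact: (qpoch_prim_eq0 pz)| |by []].
rewrite Ef; exists 0; first exact: (subring0 is_poly_subring).
by rewrite mulr0 addr0.
Qed.

Lemma habiro_eval_inj (H H' : nat -> laurent) :
  (forall m z, habiro_eval z (DJ H m) = habiro_eval z (DJ H' m)) -> H =1 H'.
Proof.
move=> E k; apply: (@laurent_ev_inj k) => z N kN pz.
set x := zeta_val z in pz *.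
pose c i := qpoch x x i * qpoch x^-1 x^-1 i.
have := @prim_fourier_inj _ N x pz
  (fun i => c i * (ev z (laurent_val (H i)) - ev z (laurent_val (H' i)))).
move=> /(_ _ k kN) /= Ek; apply/eqP; rewrite -subr_eq0.
have ck : c k != 0.
  by rewrite mulf_neq0 ?(qpoch_prim_neq0 pz) ?(qpochV_prim_neq0 pz).
rewrite -(mulrI_eq0 _ (mulfI ck)); apply/eqP/Ek => m.
have := E m z; rewrite !(habiro_eval_DJ _ _ pz) => /eqP.
rewrite -subr_eq0 -sumrB => /eqP Em.
rewrite -[RHS]Em; apply: eq_bigr => i _.
(* Fourier inversion is stated for natural [m], so the integer power of [x] becomes a natural
   one. *)
rewrite -/x /c -[(i%:Z * m%:Z)]PoszM; change (x ^ (i * m)%N) with (x ^+ (i * m)).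
ring.
Qed.

(** * Injectivity of the series expansion in the colored Habiro ring *)

Lemma sqr_subr1 (F : fieldType) (x : F) :
  x != 0 -> (x - 1) ^+ 2 = x * (x + x^-1 - 2).
Proof. by move=> x0; field. Qed.

Lemma subr_cross (V : zmodType) (s a a' t t' : V) :
  s + a' + t' = s + a + t -> a - a' = t' - t.
Proof.
rewrite -!addrA => /addrI E; apply: (addIr a'); rewrite subrK.
by apply: (addIr t); rewrite addrAC subrK addrC -E addrC.
Qed.

Section ColoredHabiro.
Variables (C : fieldType) (C0 : set C) (b : C).
Hypotheses (subC0 : is_subring C0) (b0 : b != 0) (C0b : C0 b) (C0bV : C0 b^-1).

Local Notation xvar := (xvar C).
Let toC : {rmorphism C -> {fraction {poly C}}} :=
  (@FracField.tofrac {poly C}) \o polyC.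

Let xvar_neq0 : xvar != 0. Proof. exact: tofracX_neq0. Qed.

(* [x^n P(x + 1/x - 2)], with [n] the degree of [P], is a polynomial in [x]
   whose value at 0 is the leading coefficient of [P]. *)
Lemma horner_xring_eq0 (P : {poly C}) :
  (map_poly toC P).[xvar + xvar^-1 - 2] = 0 -> P = 0.
Proof.
have [//|P0 E] := eqVneq P 0; exfalso.
have sP : (0 < size P)%N by rewrite size_poly_gt0.
pose n := (size P).-1.
(* In degree [i], the factor [x^i] of [x^n] clears the denominator of
   [(x + 1/x - 2)^i = ((x - 1)^2 / x)^i], and [x^(n - i)] is left over. *)
pose Q : {poly C} :=
  \sum_(i < size P) (P`_i)%:P * (('X - 1) ^+ 2) ^+ i * 'X^(n - i).
have Q0 : Q = 0.
  apply/eqP; rewrite -tofrac_eq0; apply/eqP.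
  rewrite -[RHS](mulr0 (xvar ^+ n)) -E horner_coef size_map_poly mulr_sumr.
  rewrite /Q raddf_sum; apply: eq_bigr => i _.
  rewrite coef_map /= !tofracM !tofracXn tofracB tofrac1 -/xvar.
  have -> : xvar ^+ n = xvar ^+ i * xvar ^+ (n - i).
    by rewrite -exprD subnKC // -ltnS /n prednK.
  have -> : (xvar - 1) ^+ 2 = xvar * (xvar + xvar^-1 - 2).
    exact: sqr_subr1 xvar_neq0.
  by rewrite exprMn mulrCA mulrAC.
have := congr1 (fun R : {poly C} => R.[0]) Q0.
rewrite horner0 /Q horner_sum.
have nP : (n < size P)%N by rewrite prednK.
rewrite (bigD1 (Ordinal nP)) //= big1 ?addr0 => [|i ine]; last first.
  rewrite hornerM hornerXn expr0n subn_eq0 leqNgt.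
  have -> : (i < n)%N; last by rewrite mulr0.
  rewrite ltn_neqAle -ltnS /n prednK // ltn_ord andbT.
  by apply: contra ine => /eqP Ei; apply/eqP/val_inj.
rewrite subnn expr0 mulr1 hornerM hornerC horner_exp horner_exp.
rewrite hornerD hornerN hornerX hornerC sub0r sqrrN expr1n expr1n mulr1.
by move/eqP; rewrite -lead_coefE lead_coef_eq0 (negPf P0).
Qed.

(** Each factor [1 - c d^j x] takes the value 1 at [x = 0]. *)
Lemma cxk_neq0 k : cxk xvar (toC b) k != 0.
Proof.
have h (c d : C) : qpoch (toC c * xvar) (toC d) k != 0.
  apply: qpoch_neq0 => j _.
  rewrite -rmorphXn mulrAC -rmorphM /= -tofracM -tofrac1 tofrac_eq.
  apply/eqP => /(congr1 (fun p : {poly C} => p.[0])) /eqP.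
  by rewrite hornerM hornerX mulr0 hornerC eq_sym oner_eq0.
have hV : qpoch ((toC b)^-1 * xvar) (toC b)^-1 k != 0 by rewrite -fmorphV h.
apply: mulf_neq0 hV; apply: mulf_neq0 (h b b).
by rewrite invr_eq0; exact: expf_neq0 xvar_neq0.
Qed.

(** Strong induction on [k]: comparing the series modulo [c_(k+1)] and cancelling [c_k] leaves a
    constant divisible by a linear polynomial in [x + 1/x - 2], hence zero. *)
Lemma DJx_series_inj (h h' : nat -> C) (C0h : forall k, C0 (h k))
    (C0h' : forall k, C0 (h' k)) (m : int) :
  DJx_series subC0 b0 C0b C0bV C0h m = DJx_series subC0 b0 C0b C0bV C0h' m ->
  h =1 h'.
Proof.
move=> E; elim/ltn_ind => k IH.
have subX := in_xring_subring subC0.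
(* Any representative of this coset lies, by [E], in the components of both series. *)
have [f _ Ef] := component_coset (DJx_series subC0 b0 C0b C0bV C0h m) k.+1.
have cf : component (DJx_series subC0 b0 C0b C0bV C0h m) k.+1 f.
  rewrite Ef; exists 0; last by rewrite mulr0 addr0.
  exact: subring0.
have cf' := cf; rewrite E in cf'.
case: cf => _ [t Xt E1]; case: cf' => _ [t' Xt' E2].
have bm : b ^ (k%:Z * m) != 0 by rewrite expfz_neq0.
pose y := xvar + xvar^-1 - 2 : {fraction {poly C}}.
(* The value of [y] at [x = b^(k+1)], so that [c_(k+1) = c_k (y - e)]. *)
pose e := b ^+ k.+1 + b^-1 ^+ k.+1 - 2.
have cS : cxk xvar (toC b) k.+1 = cxk xvar (toC b) k * (y - toC e).
  rewrite [LHS](cxkS b0) -/toC /y /e rmorphB rmorphD rmorph_nat /=.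
  by congr (_ * _); ring.
have Ed : toC ((h k - h' k) * b ^ (k%:Z * m)) = (y - toC e) * (t' - t).
  apply: (mulfI (cxk_neq0 k)); rewrite mulrA -cS mulrBl rmorphB !mulrBr.
  move: E1; rewrite E2 !big_ord_recr /=.
  rewrite (eq_bigr (fun i : 'I_k => cxk xvar (toC b) i *
     toC (h i * b ^ (i%:Z * m)))); last by move=> i _; rewrite -IH.
  exact: subr_cross.
have [P _ EP] : in_xring C0 (t' - t) by exact: subringB.
(* By [horner_xring_eq0], [y] is transcendental over [C], so [Ed] lifts to an identity of
   polynomials, which can be evaluated at [e]. *)
have EQ : ('X - e%:P) * P = ((h k - h' k) * b ^ (k%:Z * m))%:P.
  apply/eqP; rewrite -subr_eq0; apply/eqP/horner_xring_eq0.
  rewrite rmorphB rmorphM rmorphB /= map_polyX !(map_polyC toC).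
  rewrite hornerD hornerN hornerM hornerXsubC hornerC -/y.
  rewrite -[X in _ - X]/(toC ((h k - h' k) * b ^ (k%:Z * m))) Ed EP.
  exact: subrr.
have := congr1 (fun p : {poly C} => p.[e]) EQ.
rewrite hornerM hornerXsubC subrr mul0r hornerC => /esym/eqP.
by rewrite mulf_eq0 (negPf bm) orbF subr_eq0 => /eqP.
Qed.

End ColoredHabiro.

(** * The equivalence of the eight families *)

Theorem proposition2p2 (R : realType) (K K' : set (S3 R))
    (knotK : knot K) (knotK' : knot K') (H H' : nat -> laurent)
    (HK : habiro_polynomials K H) (HK' : habiro_polynomials K' H') :
  [<->
    (* 1 *)
    (forall n : nat, (0 < n)%N -> colored_jones K n = colored_jones K' n)
      /\ DJ H 0 = DJ H' 0;
    (* 2 *)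
    forall m : int,
      (forall n : nat, (0 < n)%N -> DJn H m n = DJn H' m n)
      /\ DJ H m = DJ H' m;
    (* 3 *)
    forall m : int, DJx H m = DJx H' m;
    (* 4 *)
    forall m : int, DJ H m = DJ H' m;
    (* 5 *)
    forall z : unity_root,
      (forall n : nat, (0 < n)%N ->
         ev z (colored_jones K n) = ev z (colored_jones K' n))
      /\ habiro_eval z (DJ H 0) = habiro_eval z (DJ H' 0);
    (* 6 *)
    forall (m : int) (z : unity_root),
      (forall n : nat, (0 < n)%N -> ev z (DJn H m n) = ev z (DJn H' m n))
      /\ habiro_eval z (DJ H m) = habiro_eval z (DJ H' m);
    (* 7 *)
    forall (m : int) (z : unity_root), DJx_zeta H m z = DJx_zeta H' m z;
    (* 8 *)
    forall (m : int) (z : unity_root),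
      habiro_eval z (DJ H m) = habiro_eval z (DJ H' m)].
Proof.
have E1 : (forall n, (0 < n)%N -> colored_jones K n = colored_jones K' n) ->
    H = H'.
  move=> E; apply/funext => k; apply: laurent_inj; move: k.
  by apply: cnk_sum_inj => n n0; rewrite -HK // -HK' // E.
have E8 : (forall m z, habiro_eval z (DJ H m) = habiro_eval z (DJ H' m)) ->
    H = H'.
  by move=> E; apply/funext; exact: habiro_eval_inj.
have HH' n : H = H' -> (0 < n)%N -> colored_jones K n = colored_jones K' n.
  by move=> E n0; rewrite HK // HK' // E.
(* The implications form a cycle from each family to the next and from the eighth to the first; each
   one goes through [H = H']. *)
tfae.
- by case=> /E1 -> _.
- by move=> E; have -> : H = H' by apply: E8 => m z; case: (E m) => _ ->.
- move=> E; have -> // : H = H'; apply/funext => k; apply: laurent_inj.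
  exact: (DJx_series_inj (E 0)).
- move=> E z; have EH : H = H' by apply: E8 => m w; rewrite E.
  by split=> [n n0|]; [rewrite HH'|rewrite EH].
- move=> E; have -> // : H = H'; apply: E1 => n n0.
  rewrite HK // HK' //.
  (* The Habiro expansion shows that the colored Jones polynomials are Laurent polynomials, as
     [laurent_ev_inj] requires. *)
  pose J G := Laurent (cnk_sum_laurent G n).
  apply: (congr1 laurent_val (x := J H) (y := J H')).
  apply: (@laurent_ev_inj 0) => z _ _ _ /=.
  by rewrite -HK // -HK' //; case: (E z) => ->.
- by move=> E; have -> // : H = H' by apply: E8 => m z; case: (E m z).
- move=> E; have -> // : H = H'; apply/funext => k.
  (* The series at [z] recovers [ev z] of every [H k] whatever the order of [z], hence the bound
     0. *)
  apply: (@laurent_ev_inj 0) => z _ _ _.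
  exact: (DJx_series_inj (E 0 z)).
- move=> /E8 EH; split=> [n n0|]; [exact: HH'|by rewrite EH].
Qed.
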